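(* For $g \geq 2$, let $f_{g,e}$ denote the number of isomorphism classes of genus $g$ combinatorial types $(G,w)$ with $|E(G)| = e$. Then: (i) there are $42$ isomorphism classes of genus $3$ combinatorial types, and $(f_{3,0},\dots,f_{3,6}) = (1,2,5,9,12,8,5)$; (ii) there are $379$ isomorphism classes of genus $4$ combinatorial types, and $(f_{4,0},\dots,f_{4,9}) = (1,3,7,21,43,75,89,81,42,17)$; (iii) there are $4555$ isomorphism classes of genus $5$ combinatorial types, and $(f_{5,0},\dots,f_{5,12}) = (1,3,11,34,100,239,492,784,1002,926,632,260,71)$.
   Context: A combinatorial type is a pair $(G,w)$ where $G$ is a finite connected graph (loops and parallel edges allowed) and $w: V(G) \to \mathbb{Z}_{\geq 0}$ is a vertex weight function such that every vertex of weight $0$ has degree at least $3$. Its genus is $|E(G)|-|V(G)|+1+\sum_{v \in V(G)} w(v)$. Two combinatorial types are isomorphic if there is a graph isomorphism between them preserving vertex weights. (These isomorphism classes are the cells of the moduli space $M^{\mathrm{tr}}_g$ of tropical curves, the cell of $(G,w)$ having dimension $|E(G)|$.) *)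

(* Defs.v *)
From HB Require Import structures.
From mathcomp Require Import all_boot all_order all_algebra.

Set Implicit Arguments.
Unset Strict Implicit.
Unset Printing Implicit Defensive.

Import GRing.Theory.
Local Open Scope ring_scope.

(* An edge is sent to its set of endpoints: one vertex for a loop, two otherwise. *)
Record multigraph := Multigraph {
  vertex : finType;
  edge : finType;
  ends : edge -> {set vertex};
  ends_card : forall e : edge, (0 < #|ends e| <= 2)%N
}.

Definition adjacent (G : multigraph) : rel (vertex G) :=
  fun u v => [exists e : edge G, ends e == [set u; v]%SET].

(* The graph with no vertex is not connected. *)
Definition connected_graph (G : multigraph) : Prop :=
  (0 < #|vertex G|)%N /\ forall u v : vertex G, connect (@adjacent G) u v.

(* A loop contributes 2 to the degree of its vertex. *)
Definition degree (G : multigraph) (v : vertex G) : nat :=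
  (\sum_(e : edge G | v \in ends e) (if #|ends e| == 1 then 2 else 1))%N.

Record comb_type := CombType {
  graph :> multigraph;
  weight : vertex graph -> nat;
  comb_type_connected : connected_graph graph;
  comb_type_stable : forall v : vertex graph, weight v = 0%N -> (3 <= degree v)%N
}.

Definition genus (G : comb_type) : int :=
  #|edge G|%:Z - #|vertex G|%:Z + 1 + (\sum_(v : vertex G) @weight G v)%N%:Z.

Definition isomorphic (G H : comb_type) : Prop :=
  exists (fV : vertex G -> vertex H) (fE : edge G -> edge H),
    [/\ bijective fV, bijective fE,
        forall e : edge G, ends (fE e) = (fV @: ends e)%SET
      & forall v : vertex G, @weight H (fV v) = @weight G v].

(* The set {x | A x} has exactly n elements.  Sets of combinatorial types are
   plain predicates because comb_type, which quantifies over finType, lives in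
   a universe too large for the set type of mathcomp.classical. *)
Definition has_card (T : Type) (A : T -> Prop) (n : nat) : Prop :=
  exists f : 'I_n -> T,
    (forall i j : 'I_n, f i = f j -> i = j) /\
    (forall x : T, A x <-> exists i : 'I_n, f i = x).

Definition iso_class (G : comb_type) : comb_type -> Prop :=
  fun H => isomorphic G H.

Definition iso_classes (g : nat) : (comb_type -> Prop) -> Prop :=
  fun C => exists G : comb_type, genus G = g%:Z /\ C = iso_class G.

Definition iso_classes_edges (g e : nat) : (comb_type -> Prop) -> Prop :=
  fun C => exists G : comb_type,
    [/\ genus G = g%:Z, #|edge G| = e & C = iso_class G].

(* Main.v *)
(* Order the vertices of a combinatorial type G as v_0, ..., v_(n-1) and record,
   for each i, the row made of the multiplicities of the edges v_i v_j (j < i)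
   followed by the weight, the number of loops and the number of non-loop
   half-edges at v_i.  The lexicographically largest such code is a complete
   isomorphism invariant.  A prefix of a maximal ordering is itself maximal
   among the sequences of its length, and since G is connected each of its
   rows but the first has a nonzero multiplicity.  The excesses
   2 w(v) - 2 + deg(v) >= 1 add up to 2g - 2, so a depth-first search over rows
   that discards non-maximal prefixes lists the maximal codes of genus g. *)

Require Import Defs.
From mathcomp Require Import all_boot all_order all_algebra.
From mathcomp Require Import zify.
From Stdlib Require Import PeanoNat FunctionalExtensionality PropExtensionality.

Set Implicit Arguments.
Unset Strict Implicit.
Unset Printing Implicit Defensive.

(** * Lexicographic codes of vertex orderings *)

Fixpoint lexcmp (T : Type) (cmp : T -> T -> comparison) (s t : seq T) :
    comparison :=
  match s, t with
  | [::], [::] => Eq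
  | [::], _ :: _ => Lt
  | _ :: _, [::] => Gt
  | x :: s', y :: t' => if cmp x y is Eq then lexcmp cmp s' t' else cmp x y
  end.

Definition total_cmp (T : Type) (cmp : T -> T -> comparison) :=
  [/\ forall x y, cmp x y = Eq <-> x = y,
      forall x y, cmp y x = CompOpp (cmp x y)
    & forall x y z, cmp x y = Lt -> cmp y z = Lt -> cmp x z = Lt].

Lemma lexcmp_total (T : Type) (cmp : T -> T -> comparison) :
  total_cmp cmp -> total_cmp (lexcmp cmp).
Proof.
move=> [cmpE cmpC cmp_tr]; split.
- elim=> [|x s IH] [|y t] //=; case E: (cmp x y) (cmpE x y) => // -[h1 h2].
  + split=> [/IH->|[_ <-]]; first by rewrite h1.
    exact/IH.
  + by split=> // -[/h2].
  + by split=> // -[/h2].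
- elim=> [|x s IH] [|y t] //=; rewrite (cmpC x y).
  by case: (cmp x y) => //=; exact: IH.
- elim=> [|x s IH] [|y t] [|z u] //=.
  case Exy: (cmp x y) => //; case Eyz: (cmp y z) => // st tu.
  + have /cmpE -> := Exy; rewrite Eyz; exact: IH st tu.
  + by have /cmpE -> := Exy; rewrite Eyz.
  + by have /cmpE <- := Eyz; rewrite Exy.
  + by rewrite (cmp_tr _ _ _ Exy Eyz).
Qed.

Lemma nat_compare_total : total_cmp Nat.compare.
Proof.
split=> [x y|x y|x y z].
- exact: Nat.compare_eq_iff.
- exact: Nat.compare_antisym.
- rewrite !Nat.compare_lt_iff; exact: Nat.lt_trans.
Qed.

Definition row_cmp := lexcmp Nat.compare.
Definition code_cmp := lexcmp row_cmp.

Lemma row_cmp_total : total_cmp row_cmp.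
Proof. exact/lexcmp_total/nat_compare_total. Qed.

Lemma code_cmp_total : total_cmp code_cmp.
Proof. exact/lexcmp_total/row_cmp_total. Qed.

Lemma total_cmp_refl (T : Type) (cmp : T -> T -> comparison) x :
  total_cmp cmp -> cmp x x = Eq.
Proof. by case=> cmpE _ _; apply/cmpE. Qed.

Lemma total_cmp_anti (T : Type) (cmp : T -> T -> comparison) x y :
  total_cmp cmp -> cmp x y <> Gt -> cmp y x <> Gt -> x = y.
Proof.
case=> cmpE cmpC _; rewrite (cmpC x y).
by case: (cmp x y) (cmpE x y) => // -[h _]; auto.
Qed.

Lemma total_cmp_max (I : eqType) (T : Type) (cmp : T -> T -> comparison)
    (f : I -> T) (i0 : I) (s : seq I) :
    total_cmp cmp ->
  exists2 i, i \in i0 :: s & {in i0 :: s, forall j, cmp (f j) (f i) <> Gt}.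
Proof.
move=> cmpT; have [cmpE cmpC cmp_tr] := cmpT.
elim: s i0 => [|i1 s IH] i0.
  exists i0; rewrite ?mem_head // => j.
  by rewrite inE => /eqP->; rewrite total_cmp_refl.
have [i i_s max_i] := IH i1.
case E: (cmp (f i0) (f i)).
- exists i; first by rewrite inE i_s orbT.
  by move=> j; rewrite inE => /predU1P[->|/max_i //]; rewrite E.
- exists i; first by rewrite inE i_s orbT.
  by move=> j; rewrite inE => /predU1P[->|/max_i //]; rewrite E.
- exists i0; first exact: mem_head.
  move=> j; rewrite inE => /predU1P[->|/max_i].
    by rewrite total_cmp_refl.
  have lt_i: cmp (f i) (f i0) = Lt by rewrite cmpC E.
  case Ej: (cmp (f j) (f i)) => // _.
    by have /cmpE -> := Ej; rewrite lt_i.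
  by rewrite (cmp_tr _ _ _ Ej lt_i).
Qed.

Lemma lexcmp_cat (T : Type) (cmp : T -> T -> comparison) s1 s2 t1 t2 :
    size s1 = size t1 ->
  lexcmp cmp (s1 ++ s2) (t1 ++ t2) =
  if lexcmp cmp s1 t1 is Eq then lexcmp cmp s2 t2 else lexcmp cmp s1 t1.
Proof.
elim: s1 t1 => [|x s1 IH] [|y t1] //= [/IH->].
by case: (cmp x y).
Qed.

Lemma code_cmp_cons r c r' c' :
  code_cmp (r :: c) (r' :: c') =
  if row_cmp r r' is Eq then code_cmp c c' else row_cmp r r'.
Proof. by []. Qed.

Section Code.

Variables (V : eqType) (m : V -> V -> nat) (col : V -> seq nat).

Definition row (s : seq V) (v : V) : seq nat := [seq m v u | u <- s] ++ col v.

Fixpoint code_from (s t : seq V) : seq (seq nat) :=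
  if t is v :: t' then row s v :: code_from (rcons s v) t' else [::].

Definition code := code_from [::].

(** Tests that no extension of [s] by distinct elements of [A] has a code above [c]; a branch is
    left as soon as its row is strictly smaller. Under call-by-value evaluation a disjunction would
    explore the branch of a [v] already in [s]; the conditional prevents this. *)
Fixpoint dominates (A s : seq V) (c : seq (seq nat)) : bool :=
  if c is r :: c' then
    all (fun v => if v \in s then true else
      match row_cmp (row s v) r with
      | Gt => false | Lt => true | Eq => dominates A (rcons s v) c' end) A
  else true.

Definition maximal (s : seq V) : Prop :=
  forall t, uniq t -> size t = size s -> code_cmp (code t) (code s) <> Gt.

Lemma size_code_from s t : size (code_from s t) = size t.
Proof. by elim: t s => //= v t IH s; rewrite IH. Qed.

Lemma code_from_cat s t1 t2 :
  code_from s (t1 ++ t2) = code_from s t1 ++ code_from (s ++ t1) t2.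
Proof.
elim: t1 s => [|v t1 IH] s /=; first by rewrite cats0.
by rewrite IH cat_rcons.
Qed.

Lemma code_cat s t : code (s ++ t) = code s ++ code_from s t.
Proof. exact: code_from_cat. Qed.

Lemma code_rcons s v : code (rcons s v) = rcons (code s) (row s v).
Proof. by rewrite -cats1 code_cat /= cats1. Qed.

Lemma nth_code x0 s i : i < size s ->
  nth [::] (code s) i = row (take i s) (nth x0 s i).
Proof.
move=> lt_i; rewrite -{1}(cat_take_drop i s) code_cat nth_cat size_code_from.
by rewrite size_takel ?(ltnW lt_i) // ltnn subnn (drop_nth x0 lt_i).
Qed.

Lemma dominates_le A s c t :
    dominates A s c -> size t = size c -> uniq (s ++ t) -> {subset t <= A} ->
  code_cmp (code_from s t) c <> Gt.
Proof.
elim: c s t => [|r c IH] s [|v t] //= /allP dom [sz_t] Ust tA.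
have vA : v \in A by apply: tA; rewrite mem_head.
have vs : v \notin s.
  by move: Ust; rewrite uniq_catC /= mem_cat negb_or => /andP[/andP[]].
move: (dom v vA); rewrite (negPf vs) code_cmp_cons.
case: (row_cmp _ _) => // dom'; apply: IH; rewrite ?cat_rcons //.
by move=> u ut; apply: tA; rewrite inE ut orbT.
Qed.

(** A row that beats [c] may occur at any depth, on a sequence that [A] cannot extend to full
    length. Hence the hypothesis compares sequences of every length with the prefix of [c] of that
    length. *)
Lemma le_dominates A s c :
    (forall t, size t <= size c -> uniq (s ++ t) -> uniq s -> {subset t <= A} ->
       code_cmp (code_from s t) (take (size t) c) <> Gt) ->
  uniq s -> dominates A s c.
Proof.
elim: c s => [|r c IH] s //= le_c Us; apply/allP=> v vA.
case: ifP => // /negbT vs.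
have Usv : uniq (rcons s v) by rewrite rcons_uniq vs.
have := le_c [:: v] isT; rewrite cats1 /= take0 code_cmp_cons => /(_ Usv Us).
case E: (row_cmp _ _) => // lt_c; last first.
  by case: lt_c => // u; rewrite inE => /eqP->.
apply: IH => // t sz_t; rewrite cat_rcons => Ut _ tA.
have := le_c (v :: t) sz_t Ut Us; rewrite /= code_cmp_cons E; apply=> u.
by rewrite inE => /predU1P[->|/tA].
Qed.

End Code.

(** A row relates a vertex only to earlier, hence distinct, ones, so agreement of the multiplicities
    off the diagonal suffices. This matters for [cmult], which is not a multiplicity on the
    diagonal. *)
Lemma code_from_map (V W : eqType) (f : V -> W) (mV : V -> V -> nat)
    (mW : W -> W -> nat) colV colW s t :
    uniq (s ++ t) ->
    {in s ++ t &, forall v u, v != u -> mW (f v) (f u) = mV v u} ->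
    {in s ++ t, forall v, colW (f v) = colV v} ->
  code_from mW colW (map f s) (map f t) = code_from mV colV s t.
Proof.
elim: t s => //= v t IH s Ust mE colE.
have vst : v \in s ++ v :: t by rewrite mem_cat mem_head orbT.
rewrite -map_rcons IH ?cat_rcons // /row colE // -map_comp.
congr ((_ ++ _) :: _).
apply/eq_in_map => u us /=; rewrite mE //; first by rewrite mem_cat us.
apply: contraTneq us => <-.
by move: Ust; rewrite uniq_catC /= mem_cat negb_or => /andP[/andP[]].
Qed.

(** A sequence [s'] as long as [s] with a larger code would keep its advantage when completed by
    arbitrary further vertices [r] to the length of [s ++ t], because the lexicographic comparison
    is decided within the prefix. *)
Lemma maximal_prefix (V : finType) (m : V -> V -> nat) col s t :
  uniq (s ++ t) -> maximal m col (s ++ t) -> maximal m col s.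
Proof.
move=> Ust max_st s' Us' sz_s'.
pose r := take (size t) [seq v <- enum V | v \notin s'].
(* Enough vertices lie outside [s'], since [s'] is as long as [s] and [s ++ t] has no repetition. *)
have sz_r : size r = size t.
  apply: size_takel.
  rewrite size_filter -(leq_add2l (size s')) {1}sz_s' -size_cat.
  have -> : size s' = count (mem s') (enum V).
    rewrite -size_filter; apply/perm_size/uniq_perm => //.
      exact/filter_uniq/enum_uniq.
    by move=> v; rewrite mem_filter mem_enum andbT.
  by rewrite count_predC -cardT -(card_uniqP Ust) max_card.
have Us'r : uniq (s' ++ r).
  rewrite cat_uniq Us' /= (take_uniq _ (filter_uniq _ (enum_uniq _))) andbT.
  by apply/hasPn=> v /mem_take; rewrite mem_filter => /andP[].
have := max_st _ Us'r; rewrite !size_cat sz_s' sz_r => /(_ erefl).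
rewrite !code_cat /code_cmp lexcmp_cat ?size_code_from // -/code_cmp.
by case: (code_cmp _ _).
Qed.

(** * Edge multiplicities and genus *)

(** The map [F] sends the k-th element of each fibre of [f] to the k-th element of the fibre of [g]
    over the same point. *)
Lemma equifiber_bijection (A B : finType) (T : eqType)
    (f : A -> T) (g : B -> T) :
    (forall t, #|[set a | f a == t]| = #|[set b | g b == t]|) ->
  exists2 h : A -> B, bijective h & forall a, g (h a) = f a.
Proof.
pose F (A B : finType) (f : A -> T) (g : B -> T) b0 a :=
  nth b0 (enum [set b | g b == f a]) (index a (enum [set a' | f a' == f a])).
have FP (A' B' : finType) (f' : A' -> T) (g' : B' -> T) b0 a0 a :
    (forall t, #|[set a | f' a == t]| = #|[set b | g' b == t]|) ->
    g' (F _ _ f' g' b0 a) = f' a /\ F _ _ g' f' a0 (F _ _ f' g' b0 a) = a.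
  move=> fgE.
  have a_in : a \in enum [set a' | f' a' == f' a] by rewrite mem_enum inE.
  have lt_a : index a (enum [set a' | f' a' == f' a])
              < size (enum [set b | g' b == f' a]).
    by rewrite -cardE -fgE cardE index_mem.
  have gF : g' (F _ _ f' g' b0 a) = f' a.
    by have := mem_nth b0 lt_a; rewrite mem_enum inE => /eqP.
  by split=> //; rewrite {1}/F gF index_uniq ?enum_uniq // nth_index.
(* [F] needs default elements, so an empty [A] is treated apart: all fibres of [g] are then empty,
   and so is [B]. *)
move=> fgE; case: (pickP A) => [a0 _|A0]; last first.
  have h (a : A) : B by have := A0 a.
  exists h => [|a]; last by have := A0 a.
  apply: inj_card_bij => [a|]; first by have := A0 a.
  rewrite leqNgt; apply/negP=> /(leq_ltn_trans (leq0n _))/card_gt0P[b _].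
  have /card_gt0P[a _] : 0 < #|[set a | f a == g b]|.
    by rewrite fgE; apply/card_gt0P; exists b; rewrite inE.
  by have := A0 a.
have /card_gt0P[b0 _] : 0 < #|[set b | g b == f a0]|.
  by rewrite -fgE; apply/card_gt0P; exists a0; rewrite inE.
have gfE t : #|[set b | g b == t]| = #|[set a | f a == t]| by rewrite fgE.
exists (F _ _ f g b0) => [|a]; last by have [] := FP _ _ _ _ b0 a0 a fgE.
exists (F _ _ g f a0) => [a|b]; first by have [] := FP _ _ _ _ b0 a0 a fgE.
by have [] := FP _ _ _ _ a0 b0 b gfE.
Qed.

Lemma eq_set2l (T : finType) (a b c : T) :
  ([set a; b] == [set a; c]) = (b == c).
Proof.
apply/eqP/eqP=> [E|-> //].
have: b \in [set a; c] by rewrite -E !inE eqxx orbT.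
have: c \in [set a; b] by rewrite E !inE eqxx orbT.
by rewrite !inE => /pred2P[->|->//]; case/orP=> /eqP.
Qed.

Lemma ends_pair (G : multigraph) (e : edge G) :
  exists u v, ends e = [set u; v].
Proof.
have := ends_card e; case E: #|ends e| => [|[|[|k]]] // _.
  by have /cards1P[u ->] := introT eqP E; exists u, u; rewrite setUid.
have /cards2P[u [v [_ ->]]] := introT eqP E; by exists u, v.
Qed.

(** For [u = v] the pair collapses to a singleton, so [mult v v] is the number of loops at [v]. *)
Definition mult (G : multigraph) (v u : vertex G) : nat :=
  #|[set e : edge G | ends e == [set v; u]]|.

Definition valence (G : multigraph) (v : vertex G) : nat :=
  \sum_(u | u != v) mult v u.

Definition colour (G : comb_type) (v : vertex G) : seq nat :=
  [:: weight v; mult v v; valence v].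

(* Two more than the excess 2 w(v) - 2 + deg(v). *)
Definition excess (G : comb_type) (v : vertex G) : nat :=
  (weight v + mult v v).*2 + valence v.

Lemma multC (G : multigraph) (u v : vertex G) : mult u v = mult v u.
Proof. by rewrite /mult setUC. Qed.

(** Double counting, edge by edge: a loop at [v] is counted twice by the first term, any other edge
    at [v] once, through its other endpoint, by the second. *)
Lemma degree_mult (G : multigraph) (v : vertex G) :
  degree v = (mult v v).*2 + valence v.
Proof.
have multE u : mult v u = \sum_e (ends e == [set v; u]).
  rewrite /mult -sum1_card big_mkcond /=; apply: eq_bigr => e _.
  by rewrite inE; case: eqP.
rewrite /degree /valence (eq_bigr _ (fun u _ => multE u)) exchange_big /=.
rewrite multE -mul2n big_distrr -big_split /= big_mkcond /=.
apply: eq_bigr => e _; have [a [b ends_e]] := ends_pair e.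
(* Stated for a generic order of the endpoints, to be used with [v] as either one. *)
have aux c d : ends e = [set c; d] -> v = c ->
  (if v \in ends e then if #|ends e| == 1 then 2 else 1 else 0) =
  2 * (ends e == [set v; v]) + \sum_(u | u != v) (ends e == [set v; u]).
  move=> -> ->; rewrite !inE eqxx cards2 eq_set2l (eq_sym d).
  under eq_bigr do rewrite eq_set2l.
  have [<-|cd] := eqVneq c d.
    by rewrite big1 // => u uc; rewrite eq_sym (negPf uc).
  rewrite (bigD1 d) 1?eq_sym //= eqxx big1 // => u /andP[_ ud].
  by rewrite eq_sym (negPf ud).
have [va|va] := eqVneq v a; first exact: aux ends_e va.
have [vb|vb] := eqVneq v b; first by apply: (aux b a); rewrite // setUC.
have no u : (ends e == [set v; u]) = false.
  apply/eqP => /setP/(_ v); rewrite ends_e !inE eqxx /=.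
  by rewrite (negPf va) (negPf vb).
rewrite no ends_e !inE (negPf va) (negPf vb) big1 // => u _.
by rewrite -ends_e no.
Qed.

Lemma sum_degree (G : multigraph) : \sum_(v : vertex G) degree v = #|edge G|.*2.
Proof.
rewrite /degree (exchange_big_dep predT) //= -muln2 -sum_nat_const.
apply: eq_bigr => e _; rewrite sum_nat_const.
by have := ends_card e; case: #|_| => [|[|[]]].
Qed.

(** By the handshake identity the sum of [2 w(v) + deg(v)] is twice the total weight plus twice the
    number of edges. Moving the negative terms across keeps the equation in [nat]. *)
Lemma genus_excess (G : comb_type) (g : nat) :
  genus G = g%:Z%R <->
  \sum_(v : vertex G) excess v + 2 = (g + #|vertex G|).*2.
Proof.
have -> : \sum_(v : vertex G) excess v
        = (\sum_(v : vertex G) weight v + #|edge G|).*2.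
  rewrite doubleD -sum_degree -muln2 big_distrl -big_split /=.
  by apply: eq_bigr => v _; rewrite degree_mult /excess muln2 doubleD addnA.
by rewrite /genus; split; lia.
Qed.

(** Without such an edge [A] would be closed under adjacency, and a path from [u] to [v] could not
    leave it. *)
Lemma exists_cut_edge (G : multigraph) (A : pred (vertex G)) u v :
    connected_graph G -> A u -> ~~ A v ->
  exists x y, [/\ A x, ~~ A y & 0 < mult y x].
Proof.
move=> [_ /(_ u v) uv] Au nAv.
case: (boolP [exists x, exists y, [&& A x, ~~ A y & 0 < mult y x]]).
  by move=> /existsP[x /existsP[y /and3P[Ax Ay yx]]]; exists x, y.
move=> noE; case/negP: nAv.
suff /closed_connect/(_ u v uv) : closed (@adjacent G) A.
  by rewrite !unfold_in Au.
have closedA x y : A x -> 0 < mult y x -> A y.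
  move=> Ax yx; apply: contraR noE => Ay.
  by apply/existsP; exists x; apply/existsP; exists y; rewrite Ax Ay.
move=> x y /existsP[e /eqP ends_e]; rewrite !unfold_in.
have xy : 0 < mult x y by apply/card_gt0P; exists e; rewrite inE ends_e.
by apply/idP/idP=> [/closedA->|/closedA->]; rewrite // multC.
Qed.

(** At weight 0 the excess is the degree and stability applies. At positive weight, an excess of at
    most 2 forces weight 1 and no edge at [v]; by connectedness [G] is then a single vertex of genus
    1. *)
Lemma excess_ge3 (G : comb_type) (g : nat) (v : vertex G) :
  1 < g -> genus G = g%:Z%R -> 2 < excess v.
Proof.
move=> g_gt1 gE; rewrite ltnNge; apply/negP=> le2.
have w_gt0 : 0 < weight v.
  rewrite lt0n; apply/eqP=> w0; have := comb_type_stable w0.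
  by move: le2; rewrite degree_mult /excess w0 add0n; lia.
have val0 : valence v = 0 by move: le2; rewrite /excess; lia.
have all_v u : u = v.
  apply/eqP/negPn/negP=> uv.
  have [x [y [/eqP-> yv]]] :=
    exists_cut_edge (A := pred1 v) (comb_type_connected G) (eqxx v) uv.
  rewrite multC; move/eqP: val0; rewrite /valence sum_nat_eq0 => /forallP/(_ y).
  by rewrite yv => /eqP->.
have cV : #|vertex G| = 1 by apply/eqP/fintype1P; exists v.
have /genus_excess := gE; rewrite (bigD1 v) //= big1 => [|u]; last first.
  by rewrite (all_v u) eqxx.
by rewrite cV; lia.
Qed.

Lemma mult_isomorphic (G H : comb_type) (f : vertex G -> vertex H) :
    bijective f -> (forall u v, mult (f u) (f v) = mult u v) ->
    (forall v, @weight H (f v) = @weight G v) ->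
  isomorphic G H.
Proof.
move=> f_bij fm fw; have f_inj := bij_inj f_bij; have [f' _ f'K] := f_bij.
have im2 u v : f @: [set u; v] = [set f u; f v] by rewrite imsetU !imset_set1.
have [t|h h_bij hE] := equifiber_bijection
    (f := fun e : edge G => f @: ends e) (g := fun e : edge H => ends e).
  (* Over a pair of vertices both fibres are counted by [mult]; over any other set both are
     empty. *)
  case: (pickP (fun p => t == [set p.1; p.2])) => [[u v] /eqP->|no] /=.
    rewrite -(f'K u) -(f'K v); have := fm (f' u) (f' v); rewrite /mult => ->.
    by apply: eq_card => e; rewrite !inE -im2 (inj_eq (imset_inj f_inj)).
  rewrite !eq_card0 // => e; rewrite !inE; apply/eqP => E.
    by have [a [b eE]] := ends_pair e; move: (no (a, b)); rewrite -E eE eqxx.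
  have [a [b eE]] := ends_pair e.
  by move: (no (f a, f b)); rewrite -E eE im2 eqxx.
by exists f, h.
Qed.

Lemma isomorphic_mult (G H : comb_type) : isomorphic G H ->
  exists2 f : vertex G -> vertex H, bijective f &
    (forall u v, mult (f u) (f v) = mult u v) /\
    (forall v, colour (f v) = colour v).
Proof.
move=> [f [h [f_bij h_bij hE fw]]]; exists f => //.
have f_inj := bij_inj f_bij.
have fm u v : mult (f u) (f v) = mult u v.
  rewrite /mult -(on_card_preimset (f := h)); last exact: onW_bij.
  apply: eq_card => e; rewrite !inE hE -(inj_eq (imset_inj f_inj)).
  by rewrite imsetU !imset_set1.
split=> // v; rewrite /colour fw fm /valence.
rewrite (reindex f) /=; last exact: onW_bij.
congr [:: _; _; _]; apply: eq_big => u; first by rewrite (inj_eq f_inj).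
by rewrite fm.
Qed.

(** * Canonical codes *)

(* On the code of an ordering, cmult c v v is the weight of vertex v, not its
   number of loops. *)
Definition cmult (c : seq (seq nat)) (v u : nat) : nat :=
  if u < v then nth 0 (nth [::] c v) u else nth 0 (nth [::] c u) v.

Definition ccol (c : seq (seq nat)) (v : nat) : seq nat :=
  drop v (nth [::] c v).

(** Computable counterpart of [maximal]: the vertices are the positions in [c], with multiplicities
    and colours read off [c] itself. It thus applies to the partial codes met during the search. *)
Definition cmaximal (c : seq (seq nat)) : bool :=
  dominates (cmult c) (ccol c) (iota 0 (size c)) [::] c.

Section Decoding.

Variables (V : finType) (m : V -> V -> nat) (col : V -> seq nat).
Hypothesis mC : forall u v, m u v = m v u.

Lemma cmult_code x0 s i j : i < size s -> j < size s -> i != j ->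
  cmult (code m col s) i j = m (nth x0 s i) (nth x0 s j).
Proof.
have lt_case k l : l < k -> k < size s ->
    nth 0 (nth [::] (code m col s) k) l = m (nth x0 s k) (nth x0 s l).
  move=> lk ks; rewrite (nth_code _ _ x0) // /row nth_cat size_map.
  rewrite size_takel ?(ltnW ks) // lk.
  by rewrite (nth_map x0) ?size_takel ?(ltnW ks) // nth_take.
rewrite /cmult neq_ltn => i_s j_s; case: (ltnP j i) => [ji _|_].
  exact: lt_case.
by rewrite orbF => ij; rewrite lt_case // mC.
Qed.

Lemma ccol_code x0 s i : i < size s ->
  ccol (code m col s) i = col (nth x0 s i).
Proof.
move=> i_s; rewrite /ccol (nth_code _ _ x0) // /row drop_size_cat //.
by rewrite size_map size_takel // ltnW.
Qed.

Lemma code_decode x0 s t : uniq t -> {subset t <= iota 0 (size s)} ->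
  code (cmult (code m col s)) (ccol (code m col s)) t
  = code m col [seq nth x0 s i | i <- t].
Proof.
move=> Ut ts; have lt_s i : i \in t -> i < size s.
  by move/ts; rewrite mem_iota.
symmetry; rewrite /code -[[::]]/(map (nth x0 s) [::]).
apply: code_from_map => // [i j /lt_s i_s /lt_s j_s ij|i /lt_s i_s].
  by rewrite (cmult_code x0).
by rewrite (ccol_code x0).
Qed.

(** A sequence of positions decodes to a sequence of vertices with the same code. It is compared
    with the prefix of [s] of its length, which is maximal by [maximal_prefix]. *)
Lemma maximal_cmaximal s : uniq s -> maximal m col s -> cmaximal (code m col s).
Proof.
case: s => [//|x0 s']; set s := x0 :: s' => Us max_s.
apply: le_dominates => // t; rewrite size_code_from cat0s => sz_t Ut _ ts.
rewrite -/(code _ _ t) (code_decode x0) //.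
have -> : take (size t) (code m col s) = code m col (take (size t) s).
  rewrite -{1}(cat_take_drop (size t) s) code_cat take_size_cat //.
  by rewrite size_code_from size_takel.
apply: (@maximal_prefix _ _ _ _ (drop (size t) s)); rewrite ?cat_take_drop //.
  rewrite map_inj_in_uniq // => i j /ts; rewrite mem_iota => i_s /ts.
  by rewrite mem_iota => j_s /eqP; rewrite nth_uniq // => /eqP.
by rewrite size_map size_takel.
Qed.

End Decoding.

Lemma mem_full (V : finType) (s : seq V) v :
  uniq s -> size s = #|V| -> v \in s.
Proof.
move=> Us sz_s; apply/negPn/negP=> vs.
have Uvs : uniq (v :: s) by rewrite /= vs.
by have := max_card (mem (v :: s)); rewrite (card_uniqP Uvs) /= sz_s ltnn.
Qed.

Lemma perm_full (V : finType) (s : seq V) :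
  uniq s -> size s = #|V| -> perm_eq s (enum V).
Proof.
move=> Us sz_s; apply: uniq_perm; rewrite ?enum_uniq // => v.
by rewrite mem_full // mem_enum.
Qed.

Definition canonical (G : comb_type) (c : seq (seq nat)) : Prop :=
  exists s : seq (vertex G),
    [/\ uniq s, size s = #|vertex G|, maximal (@mult G) (@colour G) s
      & code (@mult G) (@colour G) s = c].

Lemma canonical_exists (G : comb_type) : exists c, canonical G c.
Proof.
have [s s_in max_s] := total_cmp_max (code (@mult G) (@colour G))
  (enum (vertex G)) (permutations (enum (vertex G))) code_cmp_total.
have perm_s : perm_eq s (enum (vertex G)).
  by move: s_in; rewrite inE mem_permutations => /predU1P[->|].
have sz_s : size s = #|vertex G| by rewrite (perm_size perm_s) cardE.
exists (code (@mult G) (@colour G) s), s; split => //.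
  by rewrite (perm_uniq perm_s) enum_uniq.
move=> t Ut sz_t; apply: max_s; rewrite inE mem_permutations perm_full ?orbT //.
by rewrite sz_t.
Qed.

Lemma canonical_uniq (G : comb_type) c c' :
  canonical G c -> canonical G c' -> c = c'.
Proof.
move=> [s [Us sz_s max_s <-]] [s' [Us' sz_s' max_s' <-]].
apply: total_cmp_anti code_cmp_total _ _.
  by apply: max_s' => //; rewrite sz_s sz_s'.
by apply: max_s => //; rewrite sz_s sz_s'.
Qed.

Lemma canonical_isomorphic (G H : comb_type) c :
  isomorphic G H -> canonical G c -> canonical H c.
Proof.
move=> /isomorphic_mult[f f_bij [fm fc]] [s [Us sz_s max_s <-]].
have f_inj := bij_inj f_bij; have [f' fK f'K] := f_bij.
have codeE t : uniq t -> code (@mult H) (@colour H) (map f t)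
                         = code (@mult G) (@colour G) t.
  move=> Ut; rewrite /code -[[::]]/(map f [::]).
  by apply: code_from_map => // v u _ _ _; rewrite fm.
exists (map f s); rewrite (map_inj_uniq f_inj) size_map sz_s codeE //.
split => //.
  exact: bij_eq_card f_bij.
move=> t Ut; rewrite size_map => sz_t.
have tE : t = map f (map f' t).
  by rewrite -map_comp map_id_in // => v _; rewrite /= f'K.
have Ut' : uniq (map f' t) by rewrite (map_inj_uniq (can_inj f'K)).
by rewrite tE !codeE //; apply: max_s => //; rewrite size_map.
Qed.

(** Vertices in the same position of the two orderings are matched: equal rows give equal colours
    and equal multiplicities. *)
Lemma isomorphic_canonical (G H : comb_type) c :
  canonical G c -> canonical H c -> isomorphic G H.
Proof.
move=> [s [Us sz_s _ <-]] [s' [Us' sz_s' _ cE]].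
have [/card_gt0P[x _] _] := comb_type_connected G.
have [/card_gt0P[x' _] _] := comb_type_connected H.
have sz_ss' : size s' = size s.
  by have := congr1 size cE; rewrite !size_code_from.
pose f v := nth x' s' (index v s).
have lt_s v : index v s < size s by rewrite index_mem mem_full.
have f_inj : injective f.
  move=> u v /eqP; rewrite nth_uniq ?sz_ss' // => /eqP.
  move=> uv; rewrite -(nth_index x (mem_full u Us sz_s)) uv.
  by rewrite nth_index ?mem_full.
have fc v : colour (f v) = colour v.
  rewrite -(ccol_code (@mult H) (@colour H)) ?sz_ss' // cE (ccol_code _ _ x) //.
  by rewrite nth_index ?mem_full.
apply: (@mult_isomorphic _ _ f).
- by apply: inj_card_bij => //; rewrite -sz_s -sz_s' sz_ss'.
(* Loops are compared through the colour, since multiplicities in a row concern distinct vertices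
   only. *)
- move=> u v; have [->|uv] := eqVneq u v; first by have [] := fc v.
  have ne_ind : index u s != index v s.
    apply: contra uv => /eqP E.
    by rewrite -(nth_index x (mem_full u Us sz_s)) E nth_index ?mem_full.
  rewrite -(cmult_code (@colour H) (@multC H)) ?sz_ss' // cE.
  by rewrite (cmult_code _ (@multC G) x) // !nth_index ?mem_full.
- by move=> v; have [] := fc v.
Qed.

(** Classes are predicates compared by equality, whence the two extensionality axioms. Counting
    classes thereby becomes counting codes. *)
Lemma iso_class_canonical (G : comb_type) c :
  canonical G c -> iso_class G = fun H => canonical H c.
Proof.
move=> Gc; apply: functional_extensionality => H.
apply: propositional_extensionality; split => [GH|Hc].
  exact: canonical_isomorphic GH Gc.
exact: isomorphic_canonical Gc Hc.
Qed.

Lemma sum_colours (G : comb_type) c (F : seq nat -> nat) : canonical G c ->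
  sumn [seq F (ccol c i) | i <- iota 0 (size c)]
  = \sum_(v : vertex G) F (colour v).
Proof.
move=> [s [Us sz_s _ <-]]; rewrite size_code_from.
have [/card_gt0P[x _] _] := comb_type_connected G.
rewrite -big_enum -(perm_big _ (perm_full Us sz_s)) /=.
rewrite -(big_map (@colour G) predT F) -(big_map F predT id) -sumnE; congr sumn.
apply: (@eq_from_nth _ 0) => [|i]; rewrite ?size_map ?size_iota // => i_s.
rewrite (nth_map 0) ?size_iota // nth_iota // (ccol_code _ _ x) //.
by rewrite (nth_map [::]) ?size_map // (nth_map x).
Qed.

(** Half the sum of the degrees: entries 1 and 2 of a colour are the loops and the non-loop
    half-edges. *)
Definition edge_count (c : seq (seq nat)) : nat :=
  (sumn [seq (nth 0 (ccol c i) 1).*2 + nth 0 (ccol c i) 2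
        | i <- iota 0 (size c)])./2.

Lemma canonical_edge_count (G : comb_type) c :
  canonical G c -> edge_count c = #|edge G|.
Proof.
move=> /(sum_colours (fun r => (nth 0 r 1).*2 + nth 0 r 2)).
rewrite /edge_count => -> /=.
by under eq_bigr do rewrite -degree_mult; rewrite sum_degree doubleK.
Qed.

(** * Enumeration *)

(** Candidates for the multiplicities from a new vertex to the placed ones, bounded by their free
    half-edges. *)
Fixpoint subvectors (r : seq nat) : seq (seq nat) :=
  if r is k :: r' then [seq a :: s | a <- iota 0 k.+1, s <- subvectors r']
  else [:: [::]].

Definition subv (r a : seq nat) : seq nat := [seq p.1 - p.2 | p <- zip r a].

Definition null (r : seq nat) : bool := all (pred1 0) r.

(** The ranges describe [2 (w + l) + d <= X + 2], that is, an excess of at most [X], together with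
    [d0 <= d], where [d0] half-edges already lead to placed vertices. *)
Definition colours (X d0 : nat) : seq (nat * nat * nat) :=
  [seq (wl, d) | wl <- [seq (w, l) | w <- iota 0 (X./2).+2,
                                     l <- iota 0 ((X./2).+2 - w)],
                 d <- iota d0 (X.+3 - d0 - (wl.1 + wl.2).*2)].

(* r lists the half-edges of the placed vertices that still lack a partner, and
   X is the excess left for the vertices to come.  With x = 2 (w + l) + d the
   excess of a vertex is x - 2. *)
Fixpoint gen (fuel : nat) (c : seq (seq nat)) (r : seq nat) (X : nat) :
    seq (seq (seq nat)) :=
  if fuel is fuel'.+1 then
    if X == 0 then if null r && cmaximal c then [:: c] else [::]
    else if (nilp c || ~~ null r) && cmaximal c then
      flatten [seq
        let d0 := sumn a in
        if (d0 == 0) && ~~ nilp c then [::] else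
        flatten [seq let: (w, l, d) := q in
            let x := (w + l).*2 + d in
            if x <= 2 then [::] else
            gen fuel' (rcons c (a ++ [:: w; l; d])) (rcons (subv r a) (d - d0))
              (X - (x - 2))
          | q <- colours X d0]
        | a <- subvectors r]
    else [::]
  else [::].

(** Every vertex takes at least one of the [2g - 2] units of excess, so there are at most [2g - 2]
    vertices and fuel [2g] suffices. *)
Definition gen_types (g : nat) : seq (seq (seq nat)) :=
  gen (2 * g) [::] [::] (2 * g - 2).

Lemma mem_subvectors (T : eqType) (f h : T -> nat) s :
  {in s, forall v, f v <= h v} -> map f s \in subvectors (map h s).
Proof.
elim: s => [//|v s IH] fh; rewrite !map_cons.
apply: (allpairs_f cons).
  by rewrite mem_iota add0n ltnS fh // mem_head.
by apply: IH => u us; apply: fh; rewrite inE us orbT.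
Qed.

Lemma subv_map (T : Type) (f h : T -> nat) s :
  subv (map h s) (map f s) = [seq h v - f v | v <- s].
Proof. by rewrite /subv zip_map -map_comp. Qed.

Lemma mem_colours X d0 w l d :
  d0 <= d -> (w + l).*2 + d <= X.+2 -> (w, l, d) \in colours X d0.
Proof.
move=> d0d le_X; apply/allpairsPdep; exists (w, l), d; split=> //.
  by apply/allpairsPdep; exists w, l; rewrite !mem_iota; split=> //; lia.
by rewrite mem_iota /=; lia.
Qed.

Section Completeness.

Variables (G : comb_type) (g : nat).
Hypotheses (g_gt1 : 1 < g) (gE : genus G = g%:Z%R).

Let codeG := code (@mult G) (@colour G).
Let maximalG := maximal (@mult G) (@colour G).

(* The half-edges at v leading to vertices outside s. *)
Definition free_ends (s : seq (vertex G)) (v : vertex G) : nat :=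
  valence v - \sum_(u <- s | u != v) mult v u.

Lemma valence_full (s : seq (vertex G)) v : uniq s -> size s = #|vertex G| ->
  valence v = \sum_(u <- s | u != v) mult v u.
Proof.
move=> Us sz_s; rewrite (perm_big _ (perm_full Us sz_s)) big_enum_cond /=.
exact: eq_bigl.
Qed.

Lemma free_ends_rcons s v u :
  free_ends (rcons s v) u = free_ends s u - (v != u) * mult v u.
Proof.
rewrite /free_ends -cats1 big_cat /= big_cons big_nil subnDA multC.
by case: (v != u); rewrite /= ?addn0 ?mul1n ?mul0n.
Qed.

Lemma mult_le_free_ends s v t u : uniq (s ++ v :: t) ->
    size (s ++ v :: t) = #|vertex G| -> u \in s ->
  mult v u <= free_ends s u.
Proof.
move=> Ust sz_st us; rewrite /free_ends (valence_full u Ust sz_st).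
rewrite big_cat /= addKn big_cons multC ifT ?leq_addr //.
by apply: contraTneq Ust => ->; rewrite uniq_catC /= mem_cat us orbT.
Qed.

Lemma sum_le_valence s v t : uniq (s ++ v :: t) ->
    size (s ++ v :: t) = #|vertex G| ->
  sumn [seq mult v u | u <- s] <= valence v /\
  free_ends (rcons s v) v = valence v - sumn [seq mult v u | u <- s].
Proof.
move=> Ust sz_st.
have vs : v \notin s.
  by move: Ust; rewrite uniq_catC /= mem_cat negb_or => /andP[/andP[]].
have sumE : \sum_(u <- s | u != v) mult v u = sumn [seq mult v u | u <- s].
  rewrite sumnE big_map big_seq_cond [RHS]big_seq; apply: eq_bigl => u.
  by case us: (u \in s) => //=; apply: contraNneq vs => <-.
rewrite free_ends_rcons eqxx subn0 /free_ends sumE; split=> //.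
by rewrite (valence_full v Ust sz_st) big_cat /= sumE leq_addr.
Qed.

(* Otherwise a vertex adjacent to s would give a larger code than v. *)
Lemma maximal_adjacent s v t : uniq (s ++ v :: t) -> maximalG (s ++ v :: t) ->
  s != [::] -> exists2 u, u \in s & 0 < mult v u.
Proof.
move=> Ust max_st; case: s => [//|x0 s'] in Ust max_st * => _.
set s := x0 :: s' in Ust max_st *.
have vs : v \notin s.
  by move: Ust; rewrite uniq_catC /= mem_cat negb_or => /andP[/andP[]].
have Us : uniq s by move: Ust; rewrite cat_uniq => /andP[].
have [x [y [xs ys yx]]] := exists_cut_edge (A := mem s)
  (comb_type_connected G) (mem_head x0 s') vs.
apply/hasP; apply: contraT => /hasPn no.
(* Replacing [v] by a vertex [y] adjacent to [s] leaves the rows of [s] unchanged, so only the last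
   rows compete. *)
have max_sv : maximalG (rcons s v).
  by apply: maximal_prefix (t) _ _; rewrite cat_rcons.
have := max_sv (rcons s y).
rewrite rcons_uniq ys Us !size_rcons => /(_ erefl erefl).
rewrite !code_rcons -!cats1 /code_cmp lexcmp_cat // -/code_cmp.
rewrite (total_cmp_refl _ code_cmp_total).
rewrite /= /row_cmp /row.
have : has (fun u => 0 < mult y u) s by apply/hasP; exists x.
(* The row of [v] starts with zeros on all of [s], so the first nonzero multiplicity of [y] makes
   its row larger. *)
elim: s {Us vs Ust max_st xs ys max_sv} no => //= a s IH no.
have := no a (mem_head a s); rewrite -eqn0Ngt => /eqP->.
case: (mult y a) => //= /IH; apply => u us.
by apply: no; rewrite inE us orbT.
Qed.

(** Induction on the vertices still to be placed: the search can follow the ordering [s ++ t],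
    because its prefixes are maximal, each new vertex is adjacent to an earlier one, and each has
    positive excess. *)
Lemma gen_complete t s fuel :
    uniq (s ++ t) -> size (s ++ t) = #|vertex G| -> maximalG (s ++ t) ->
    size t < fuel ->
  codeG (s ++ t)
    \in gen fuel (codeG s) (map (free_ends s) s) (\sum_(v <- t) (excess v - 2)).
Proof.
elim: t s fuel => [|v t IH] s [//|fuel] Ust sz_st max_st lt_fuel.
  rewrite cats0 in Ust sz_st max_st *; rewrite /= big_nil eqxx.
  rewrite maximal_cmaximal //; last exact: multC.
  rewrite andbT ifT ?mem_head //; apply/allP => _ /mapP[v _ ->].
  by rewrite /= /free_ends (valence_full v Ust sz_st) subnn.
have Us : uniq s by move: Ust; rewrite cat_uniq => /andP[].
have vs : v \notin s.
  by move: Ust; rewrite uniq_catC /= mem_cat negb_or => /andP[/andP[]].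
have x_gt2 := excess_ge3 v g_gt1 gE.
have adj : ~~ nilp (codeG s) -> exists2 u, u \in s & 0 < mult v u.
  rewrite /nilp size_code_from => /nilP s0.
  by apply: (maximal_adjacent Ust max_st); apply/eqP.
have [le_val freeE] := sum_le_valence Ust sz_st.
rewrite /= big_cons ifF; last by rewrite addn_eq0 subn_eq0 leqNgt x_gt2.
rewrite ifT; last first.
  rewrite maximal_cmaximal //; [|exact: multC|exact: maximal_prefix Ust max_st].
  rewrite andbT -implyNb; apply/implyP => /adj[u us vu].
  apply/allPn; exists (free_ends s u); first exact: map_f.
  by rewrite /= -lt0n (leq_trans vu) // (mult_le_free_ends Ust).
(* The branch whose vector [a] is the actual list of multiplicities from [v] to [s]. *)
apply/flattenP; eexists.
  apply/map_f/(mem_subvectors (f := fun u => mult v u)) => u us.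
  exact: mult_le_free_ends Ust sz_st us.
rewrite /= ifF; last first.
  apply/negP=> /andP[/eqP sum0 /adj[u us]].
  by rewrite ltnNge -sum0 sumnE big_map (big_rem u) //= leq_addr.
(* Within it, the branch carrying the actual colour of [v]. *)
apply/flattenP; eexists.
  apply/map_f/(@mem_colours _ _ (weight v) (mult v v) (valence v)) => //.
  by rewrite -/(excess v); lia.
rewrite /= -/(excess v) leqNgt x_gt2 /= addKn subv_map.
have := IH (rcons s v) fuel; rewrite cat_rcons => /(_ Ust sz_st max_st lt_fuel).
rewrite {2}/codeG code_rcons map_rcons freeE.
congr (_ \in gen _ _ (rcons _ _) _); apply/eq_in_map => u us.
rewrite free_ends_rcons; case: eqVneq us => [<-|]; last by rewrite mul1n.
by rewrite (negPf vs).
Qed.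

Lemma canonical_gen_types c : canonical G c -> c \in gen_types g.
Proof.
move=> [s [Us sz_s max_s <-]].
have sumE : \sum_(v : vertex G) (excess v - 2) = 2 * g - 2.
  have /genus_excess := gE.
  have -> : \sum_(v : vertex G) excess v
          = \sum_(v : vertex G) (excess v - 2) + #|vertex G| * 2.
    rewrite -sum_nat_const -big_split; apply: eq_bigr => v _ /=.
    by rewrite subnK // ltnW // (excess_ge3 _ g_gt1 gE).
  by lia.
have le_V : #|vertex G| <= 2 * g - 2.
  rewrite -sumE -sum1_card; apply: leq_sum => v _.
  by rewrite subn_gt0 (excess_ge3 _ g_gt1 gE).
have := gen_complete (t := s) (s := [::]) (fuel := 2 * g) Us sz_s max_s.
rewrite sz_s (perm_big _ (perm_full Us sz_s)) big_enum /= sumE; apply.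
by apply: leq_ltn_trans le_V _; lia.
Qed.

End Completeness.
(** * Realisation of codes *)

(** The four tests: shape of the row, connection to an earlier vertex, agreement of the recorded
    valence with the multiplicities, stability. *)
Definition valid_row (c : seq (seq nat)) (k : nat) : bool :=
  [&& size (nth [::] c k) == k + 3,
      (k == 0) || has (fun u => 0 < cmult c k u) (iota 0 k),
      nth 0 (ccol c k) 2
        == sumn [seq if u != k then cmult c k u else 0 | u <- iota 0 (size c)]
    & (0 < nth 0 (ccol c k) 0)
        || (2 < (nth 0 (ccol c k) 1).*2 + nth 0 (ccol c k) 2)].

(** Soundness is obtained by testing every listed code rather than by an invariant of [gen]. The
    numerical equation is the genus condition of [genus_excess]. *)
Definition valid (g : nat) (c : seq (seq nat)) : bool :=
  [&& 0 < size c, all (valid_row c) (iota 0 (size c)),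
      sumn [seq (nth 0 (ccol c k) 0 + nth 0 (ccol c k) 1).*2
                + nth 0 (ccol c k) 2 | k <- iota 0 (size c)] + 2
        == (g + size c).*2
    & cmaximal c].

Lemma card_tag (I : finType) (k : I -> nat) (P : pred I) :
  #|[set e : {i : I & 'I_(k i)} | P (tag e)]| = \sum_(i | P i) k i.
Proof.
rewrite -sum1_card; under eq_bigl do rewrite inE.
rewrite (eq_bigr (fun i => \sum_(j < k i) 1)); last first.
  by move=> i _; rewrite sum1_card card_ord.
by rewrite sig_big_dep /=; apply: eq_bigl => e; rewrite andbT.
Qed.

Section Realisation.

Variables (c : seq (seq nat)).
Let n := size c.
Hypothesis n_gt0 : 0 < n.
Let w k := nth 0 (ccol c k) 0.
Let l k := nth 0 (ccol c k) 1.
Let d k := nth 0 (ccol c k) 2.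
Hypothesis size_row : forall k, k < n -> size (nth [::] c k) = k + 3.
Hypothesis adjP : forall k, 0 < k < n -> exists2 u, u < k & 0 < cmult c k u.
Hypothesis dE : forall k : 'I_n, d k = \sum_(u < n | u != k) cmult c k u.
Hypothesis stable : forall k, k < n -> w k = 0 -> 2 < (l k).*2 + d k.

(** Only pairs with [p.2 <= p.1] carry edges, so each unordered pair of vertices is served once. *)
Definition bundle (p : 'I_n * 'I_n) : nat :=
  if p.1 == p.2 then l p.1 else if p.2 < p.1 then cmult c p.1 p.2 else 0.

Lemma pair_card (T : finType) (a b : T) : 0 < #|[set a; b]| <= 2.
Proof. by rewrite cards2; case: eqP. Qed.

Definition realised_graph : multigraph :=
  @Multigraph 'I_n {p : 'I_n * 'I_n & 'I_(bundle p)}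
    (fun e => [set (tag e).1; (tag e).2])
    (fun e => pair_card (tag e).1 (tag e).2).

Lemma cmultC u v : u != v -> cmult c u v = cmult c v u.
Proof. by rewrite /cmult neq_ltn; case: ltngtP. Qed.

Lemma realised_mult (i j : vertex realised_graph) :
  mult i j = if i == j then l i else cmult c i j.
Proof.
wlog ji : i j / j <= i.
  move=> th; have [ji|/ltnW ij] := leqP j i; first exact: th.
  rewrite multC th // (eq_sym j); case: eqVneq => [->//|ne].
  by rewrite cmultC // eq_sym.
rewrite /mult [LHS](card_tag bundle (fun p => [set p.1; p.2] == [set i; j])).
rewrite (bigD1 (i, j)) //= big1 => [|[a b] /= /andP[/eqP abE ab_ne]].
  rewrite addn0 /bundle /=; case: eqVneq => // ij.
  by rewrite ltn_neqAle eq_sym ij ji.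
have: a \in [set i; j] by rewrite -abE !inE eqxx.
rewrite !inE => /orP[] /eqP aE; move: abE ab_ne; rewrite aE.
  by move/eqP; rewrite eq_set2l => /eqP->; rewrite eqxx.
(* The remaining pair is [(j, i)]: it is [(i, j)] again if [i = j], and its bundle is empty if
   [j < i]. *)
rewrite [RHS]setUC => /eqP; rewrite eq_set2l => /eqP->.
rewrite /bundle /=; case: (eqVneq j i) => [->|ij _]; first by rewrite eqxx.
by rewrite ltnNge ji.
Qed.

Lemma realised_valence (i : vertex realised_graph) : valence i = d i.
Proof.
rewrite dE /valence; apply: eq_bigr => u ui.
by rewrite realised_mult eq_sym (negPf ui).
Qed.

(** By strong induction each vertex is connected to vertex 0 through an earlier neighbour. *)
Lemma realised_connected : connected_graph realised_graph.
Proof.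
pose vtx k (lt_k : k < n) : vertex realised_graph := Ordinal lt_k.
split; first by rewrite card_ord.
have adjC : connect_sym (@adjacent realised_graph).
  by apply: sym_connect_sym => u v; rewrite /adjacent setUC.
suff con0 k (lt_k : k < n) : connect (@adjacent _) (vtx 0 n_gt0) (vtx k lt_k).
  move=> [u lt_u] [v lt_v]; apply: connect_trans (con0 v lt_v).
  by rewrite adjC con0.
elim/ltn_ind: k lt_k => k IH lt_k.
have [k0|k_gt0] := posnP k.
  by rewrite (_ : vtx k lt_k = vtx 0 n_gt0) ?connect0 //; apply: val_inj.
have [|u uk ku] := adjP (k := k); first by rewrite k_gt0.
have lt_u := ltn_trans uk lt_k.
apply: connect_trans (IH u uk lt_u) (connect1 _).
have /card_gt0P[e] : 0 < mult (vtx u lt_u) (vtx k lt_k).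
  rewrite multC realised_mult ifF //.
  by apply/negP=> /eqP[ku']; rewrite ku' ltnn in uk.
by rewrite inE => ends_e; apply/existsP; exists e.
Qed.

Lemma realised_stable (v : vertex realised_graph) : w v = 0 -> 3 <= degree v.
Proof.
move=> /(stable (ltn_ord v)).
by rewrite degree_mult realised_valence realised_mult eqxx.
Qed.

Definition realised : comb_type := CombType realised_connected realised_stable.

Lemma size3 (r : seq nat) :
  size r = 3 -> r = [:: nth 0 r 0; nth 0 r 1; nth 0 r 2].
Proof. by case: r => [|a [|b [|e [|]]]]. Qed.

Lemma realised_colour (v : vertex realised) : ccol c v = colour v.
Proof.
rewrite /colour realised_valence realised_mult eqxx; apply: size3.
by rewrite size_drop size_row // addKn.
Qed.

Lemma code_iota : code (cmult c) (ccol c) (iota 0 n) = c.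
Proof.
apply: (@eq_from_nth _ [::]); rewrite size_code_from size_iota // => i i_n.
rewrite (nth_code _ _ 0) ?size_iota // take_iota (minn_idPl (ltnW i_n)).
rewrite nth_iota // add0n /row /ccol -{2}(cat_take_drop i (nth [::] c i)).
congr (_ ++ _).
apply: (@eq_from_nth _ 0); rewrite size_map size_iota.
  by rewrite size_takel // size_row // leq_addr.
move=> j ji; rewrite (nth_map 0) ?size_iota // nth_iota // nth_take //.
by rewrite /cmult ji.
Qed.

(** The natural order of the positions has code [c] by [code_iota], and [dominates_le] bounds the
    code of any other order by [c]. *)
Lemma realised_canonical : cmaximal c -> canonical realised c.
Proof.
move=> max_c; exists (enum 'I_n).
have codeE t : uniq t -> code (cmult c) (ccol c) (map val t)
                         = code (@mult realised) (@colour realised) t.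
  move=> Ut; rewrite /code -[[::]]/(map val (@nil (vertex realised))).
  apply: code_from_map => // [u v _ _ uv|v _]; last exact: realised_colour.
  by rewrite realised_mult (negPf uv).
have enumE : code (@mult realised) (@colour realised) (enum 'I_n) = c.
  by rewrite -codeE ?enum_uniq // val_enum_ord code_iota.
split=> //; first exact: enum_uniq; first by rewrite -cardE.
move=> t Ut; rewrite enumE -cardE card_ord -codeE // => sz_t.
apply: (dominates_le max_c); rewrite ?size_map //=.
  by rewrite (map_inj_uniq val_inj).
by move=> _ /mapP[i _ ->]; rewrite mem_iota /=.
Qed.

End Realisation.

Lemma valid_canonical (g : nat) c : valid g c ->
  exists2 G : comb_type, genus G = g%:Z%R & canonical G c.
Proof.
case/and4P=> n_gt0 /allP rowsP /eqP sumE max_c.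
have rowP k : k < size c -> valid_row c k.
  by move=> k_c; apply: rowsP; rewrite mem_iota.
have size_row k : k < size c -> size (nth [::] c k) = k + 3.
  by case/rowP/and4P=> /eqP.
have adjP k : 0 < k < size c -> exists2 u, u < k & 0 < cmult c k u.
  case/andP=> k_gt0 /rowP/and4P[_]; rewrite eqn0Ngt k_gt0 => /hasP[u].
  by rewrite mem_iota => uk ku _ _; exists u.
have dE (k : 'I_(size c)) :
    nth 0 (ccol c k) 2 = \sum_(u < size c | u != k) cmult c k u.
  have /rowP/and4P[_ _ /eqP-> _] := ltn_ord k.
  rewrite sumnE big_map -big_mkcond -{1}[size c]subn0.
  exact: (big_mkord (fun u => u != k)).
have stable k : k < size c -> nth 0 (ccol c k) 0 = 0 ->
    2 < (nth 0 (ccol c k) 1).*2 + nth 0 (ccol c k) 2.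
  by case/rowP/and4P=> _ _ _ + w0; rewrite w0.
exists (realised n_gt0 adjP dE stable); last exact: realised_canonical.
apply/genus_excess; rewrite /= card_ord -sumE; congr (_ + _).
have Gc := realised_canonical n_gt0 size_row adjP dE stable max_c.
by rewrite -(sum_colours (fun r => (nth 0 r 0 + nth 0 r 1).*2 + nth 0 r 2) Gc).
Qed.

(** * Counting the classes by computation *)

Lemma has_card_seq (T : Type) (I : eqType) (A : T -> Prop) (K : I -> T)
    (L : seq I) :
    uniq L -> {in L &, injective K} ->
    (forall x, A x <-> exists2 i, i \in L & x = K i) ->
  has_card A (size L).
Proof.
move=> UL Kinj AE; exists (fun i => K (tnth (in_tuple L) i)); split.
  move=> i j /Kinj E; apply/val_inj/eqP.
  have := E (mem_tnth _ _) (mem_tnth _ _).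
  have x0 := tnth (in_tuple L) i.
  by rewrite !(tnth_nth x0) /= => /eqP; rewrite nth_uniq.
move=> x; rewrite AE; split=> [[i /seq_tnthP[j ->] ->]|[i <-]].
  by exists j.
by exists (tnth (in_tuple L) i); rewrite ?mem_tnth.
Qed.

(** A list sorted for this strict order has no duplicates, which costs one linear pass instead of
    all pairwise comparisons. *)
Definition code_lt (c c' : seq (seq nat)) : bool :=
  if code_cmp c c' is Lt then true else false.

Definition check (g N : nat) (counts : seq nat) : bool :=
  let L := gen_types g in
  [&& 1 < g, sorted code_lt L, all (valid g) L, size L == N
    & [seq count (fun c => edge_count c == e) L | e <- iota 0 (size counts)]
      == counts].

(** The classes are indexed by the listed codes: [canonical_gen_types] shows that none is missed,
    [valid_canonical] that each code is realised, and uniqueness of the canonical code that distinct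
    codes give distinct classes. *)
Lemma check_has_card g N counts : check g N counts ->
  has_card (iso_classes g) N /\
  forall e, e < size counts ->
    has_card (iso_classes_edges g e) (nth 0 counts e).
Proof.
rewrite /check; set L := gen_types g.
case/and5P=> g_gt1 sorted_L /allP valid_L /eqP sz_L /eqP countsE.
have UL : uniq L.
  have [_ _ cmp_tr] := code_cmp_total.
  apply: sorted_uniq sorted_L => [c2 c1 c3|c]; rewrite /code_lt.
    case E: (code_cmp c1 c2) => // _; case E': (code_cmp c2 c3) => // _.
    by rewrite (cmp_tr _ _ _ E E').
  by rewrite (total_cmp_refl _ code_cmp_total).
pose K c (G : comb_type) := canonical G c.
have Kinj : {in L &, injective K}.
  move=> c c' /valid_L/valid_canonical[G _ Gc] _ KE.
  have Gc' : K c' G by rewrite -KE.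
  exact: canonical_uniq Gc Gc'.
split=> [|e lt_e].
  rewrite -sz_L; apply: (has_card_seq UL Kinj) => C; split.
    move=> [G [gE ->]]; have [c Gc] := canonical_exists G.
    exists c; last exact: iso_class_canonical.
    exact: (canonical_gen_types g_gt1 gE).
  move=> [c /valid_L/valid_canonical[G gE Gc] ->].
  by exists G; split; rewrite // (iso_class_canonical Gc).
rewrite -countsE (nth_map 0) ?size_iota // nth_iota // add0n -size_filter.
apply: has_card_seq (filter_uniq _ UL) _ _.
  move=> c c'; rewrite !mem_filter => /andP[_ cL] /andP[_ c'L].
  exact: Kinj.
move=> C; split.
  move=> [G [gE Ge ->]]; have [c Gc] := canonical_exists G.
  exists c; last exact: iso_class_canonical.
  rewrite mem_filter (canonical_edge_count Gc) Ge eqxx /=.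
  exact: (canonical_gen_types g_gt1 gE).
move=> [c]; rewrite mem_filter => /andP[/eqP ce] /valid_L/valid_canonical.
move=> [G gE Gc] ->; exists G.
by rewrite (iso_class_canonical Gc) -(canonical_edge_count Gc).
Qed.

Lemma check3 : check 3 42 [:: 1; 2; 5; 9; 12; 8; 5].
Proof. by vm_compute. Qed.

Lemma check4 : check 4 379 [:: 1; 3; 7; 21; 43; 75; 89; 81; 42; 17].
Proof. by vm_compute. Qed.

Lemma check5 :
  check 5 4555
    [:: 1; 3; 11; 34; 100; 239; 492; 784; 1002; 926; 632; 260; 71].
(* The conversion is left to the kernel at [Qed], so that this longest computation runs only
   once. *)
Proof. by vm_cast_no_check (erefl true). Qed.

Theorem theorem2p12 :
  (* (i) *)
  (has_card (iso_classes 3) 42 /\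
   forall e : nat, e <= 6 ->
     has_card (iso_classes_edges 3 e) (nth 0 [:: 1; 2; 5; 9; 12; 8; 5] e)) /\
  (* (ii) *)
  (has_card (iso_classes 4) 379 /\
   forall e : nat, e <= 9 ->
     has_card (iso_classes_edges 4 e)
       (nth 0 [:: 1; 3; 7; 21; 43; 75; 89; 81; 42; 17] e)) /\
  (* (iii) *)
  (has_card (iso_classes 5) 4555 /\
   forall e : nat, e <= 12 ->
     has_card (iso_classes_edges 5 e)
       (nth 0 [:: 1; 3; 11; 34; 100; 239; 492; 784; 1002; 926; 632; 260; 71] e)).
Proof.
have [c3 e3] := check_has_card check3.
have [c4 e4] := check_has_card check4.
have [c5 e5] := check_has_card check5.
by do !split.
Qed.
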